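(* Let $n\ge 1$ be an integer, let $S_1$ be the set of vertices of the left side of $Q_n$ and let $S_2$ be the set of vertices of the right side of $Q_n$. If a set $X\subseteq V(Q_n)\setminus (S_1\cup S_2)$ intersects every path in $Q_n$ from $S_1$ to $S_2$, then the subgraph of $Q_n$ induced by $X$ has tree-width at least $\frac{n}{\sqrt{18}}-1$.
   Context: For an integer $n\ge 1$, $Q_n$ is the simple undirected graph with vertex set $\{(x,y,z)\in\mathbb{Z}^3: 0\le x,y,z\le n-1\}$ in which two distinct vertices are adjacent if they can be named $(x,y,z)$ and $(x',y',z')$ in such a way that $x\le x'\le x+1$, $y\le y'\le y+1$ and $z\le z'\le z+1$. The left side of $Q_n$ is the set of vertices with first coordinate $x=0$, and the right side is the set of vertices with $x=n-1$. A path may consist of a single vertex. Tree-width is the minimum width of a tree decomposition, where width is the maximum bag size minus one. *)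

(* Defs.v *)
From mathcomp Require Import all_boot all_order all_algebra.
From mathcomp Require Import boolp reals.

Set Implicit Arguments.
Unset Strict Implicit.
Unset Printing Implicit Defensive.

Import Order.TTheory GRing.Theory Num.Theory.

Record sgraph := SGraph {
  vertex :> finType;
  adj : rel vertex;
  adj_sym : symmetric adj;
  adj_irr : irreflexive adj }.

Section Induced.
Variables (G : sgraph) (X : {set G}).
Definition induced_adj : rel {v : G | v \in X} := relpre val (@adj G).
Lemma induced_sym : symmetric induced_adj.
Proof. by move=> u v; apply: adj_sym. Qed.
Lemma induced_irr : irreflexive induced_adj.
Proof. by move=> u; apply: adj_irr. Qed.
Definition induced : sgraph := SGraph induced_sym induced_irr.
End Induced.

Definition connected (G : sgraph) : Prop := forall u v : G, connect (@adj G) u v.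

(* [ucycle] accepts the sequences [::] and [:: u; v] with u, v adjacent; only
   those of size at least 3 are cycles of the graph. *)
Definition acyclic (G : sgraph) : Prop :=
  forall c : seq G, ucycle (@adj G) c -> size c <= 2.

Definition is_tree (G : sgraph) : Prop :=
  [/\ 0 < #|G|, connected G & acyclic G].

Definition is_tree_decomposition (G T : sgraph) (B : T -> {set G}) : Prop :=
  [/\ is_tree T,
      forall v : G, exists t : T, v \in B t,
      forall u v : G, adj u v -> exists t : T, (u \in B t) && (v \in B t)
    & forall v : G, connected (induced [set t : T | v \in B t])].

Definition max_bag_size (G T : sgraph) (B : T -> {set G}) : nat :=
  \max_(t : T) #|B t|.

Definition has_max_bag_size (G : sgraph) : pred nat := fun k =>
  `[< exists (T : sgraph) (B : T -> {set G}),
        is_tree_decomposition B /\ max_bag_size B = k >].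

(* The one-bag decomposition. *)
Lemma ex_max_bag_size (G : sgraph) : exists k, has_max_bag_size G k.
Proof.
pose T := @SGraph unit (fun _ _ => false) (fun _ _ => erefl) (fun _ => erefl).
exists (max_bag_size (fun _ : T => [set: G])).
apply/asboolP; exists T, (fun _ => [set: G]); split=> //; split.
- split; first by rewrite card_unit.
  + by move=> [] []; apply: connect0.
  + by move=> [|[] [|[] c]].
- by move=> v; exists tt; rewrite inE.
- by move=> u v _; exists tt; rewrite !inE.
- by move=> v [[] p] [[] q]; rewrite (bool_irrelevance p q); apply: connect0.
Qed.

(* Integer-valued, so that the graph without vertices has tree-width -1. *)
Definition treewidth (G : sgraph) : int :=
  ((ex_minn (ex_max_bag_size G))%:Z - 1)%R.

Section Cube.
Variable n : nat.

Definition cube_vertex : finType := ('I_n * 'I_n * 'I_n)%type.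

Definition cube_step : rel cube_vertex := fun u v =>
  let: (x, y, z) := u in
  let: (x', y', z') := v in
  [&& x <= x' <= x.+1, y <= y' <= y.+1 & z <= z' <= z.+1].

Definition cube_adj : rel cube_vertex := fun u v =>
  (u != v) && (cube_step u v || cube_step v u).

Lemma cube_sym : symmetric cube_adj.
Proof. by move=> u v; rewrite /cube_adj eq_sym orbC. Qed.

Lemma cube_irr : irreflexive cube_adj.
Proof. by move=> u; rewrite /cube_adj eqxx. Qed.

Definition Q : sgraph := SGraph cube_sym cube_irr.

Definition left_side : {set Q} :=
  [set v : Q | let: (x, _, _) := (v : cube_vertex) in x == 0 :> nat].

Definition right_side : {set Q} :=
  [set v : Q | let: (x, _, _) := (v : cube_vertex) in x == n.-1 :> nat].

End Cube.

(* The path with vertex sequence u :: p; p = [::] gives a one-vertex path. *)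
Definition is_path_between (G : sgraph) (A B : {set G}) (u : G) (p : seq G)
    : Prop :=
  [/\ path (@adj G) u p, uniq (u :: p), u \in A & last u p \in B].

Definition meets_every_path (G : sgraph) (A B X : {set G}) : Prop :=
  forall (u : G) (p : seq G), is_path_between A B u p ->
    exists2 w : G, w \in u :: p & w \in X.

(* Main.v *)
Require Import Defs.
From mathcomp Require Import all_boot all_order all_algebra.
From mathcomp Require Import boolp reals zify ring.
Import Order.TTheory GRing.Theory Num.Theory.

(** The proof computes degrees mod 2 in the Kuhn triangulation of the cube, whose
    simplices are the cliques of [Q n].  Let [L] be the set of vertices
    reachable from the left side without meeting [X], and let [K] be the sum of
    the tetrahedra that meet [L].  The triangles of the boundary of [K] with all
    vertices in [X] form a surface whose boundary lies in the sides [y = 0],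
    [y = n - 1], [z = 0], [z = n - 1], and whose projection to the [yz]-square
    has degree 1.
    In a tree decomposition of [X] with bags of size at most [k], each branch
    [t'] at a node [t] carries the part of the surface that meets the vertices
    occurring only in that branch.  Its boundary lies in the bag [B t] and the
    four sides, so its degree is the same over all squares that avoid the rows
    and columns met by [B t].  The degrees of the branches at [t] sum to 1, so
    some branch [h t] has degree 1.  A self-map [h] of a tree that moves each
    node to a neighbour exchanges two adjacent nodes; but the two opposite
    branches of an edge have degrees summing to 1, as soon as some row and some
    column avoid both bags, which holds if [2 k < n - 1]. *)

Set Implicit Arguments.
Unset Strict Implicit.
Unset Printing Implicit Defensive.

(** * Trees and the branches of a tree decomposition *)

Section Tree.
Variable T : sgraph.
Hypothesis acT : acyclic T.

Definition avoid (t : T) : rel T := [rel a b | [&& adj a b, a != t & b != t]].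

Lemma avoid_sym t : connect_sym (avoid t).
Proof.
apply: sym_connect_sym => a b; rewrite /avoid /= adj_sym.
by case: (a != t); rewrite ?andbT ?andbF.
Qed.

Lemma avoid_path t a p :
  a != t -> path (avoid t) a p = path (@adj T) a p && (t \notin p).
Proof.
elim: p a => //= b p IHp a at_;
  rewrite {1}/avoid /= at_ inE negb_or (eq_sym t b) /=.
by have [->|bt] := eqVneq b t; rewrite ?andbF //= IHp // andbT andbA.
Qed.

Lemma connect_avoid_neq t a b : a != t -> connect (avoid t) a b -> b != t.
Proof.
move=> at_ /connectP[p]; rewrite avoid_path // => /andP[_ tp] ->.
by have := mem_last a p; rewrite inE => /predU1P[-> //|];
  apply: contraTneq => ->.
Qed.

Lemma adj_neq (a b : T) : adj a b -> a != b.
Proof. by apply: contraTneq => ->; rewrite adj_irr. Qed.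

(** Otherwise a path from [a] to [b] that avoids [t] would close up to a cycle through [t]. *)
Lemma branch_unique t a b :
  adj t a -> adj t b -> connect (avoid t) a b -> a = b.
Proof.
move=> ta tb /connectP[p0 /shortenP[p pP up _] eb].
have at_ : a != t by rewrite eq_sym adj_neq.
move: pP; rewrite avoid_path // => /andP[pP tp].
case: p pP up tp eb => [|c p] pP up tp eb //.
suff /acT : ucycle (@adj T) [:: t, a, c & p] by [].
rewrite /ucycle cons_uniq up inE eq_sym negb_or at_ tp.
by move: pP eb => /= pP eb; case/andP: pP => -> pP;
  rewrite ta rcons_path pP -eb adj_sym tb.
Qed.

(** The iterates of [h] end in a periodic orbit. It is a cycle of [T], so it has at most two
    elements; it does not have just one, since no node is adjacent to itself. *)
Lemma tree_fixed_edge (h : T -> T) :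
  0 < #|T| -> (forall t, adj t (h t)) -> exists t, h (h t) = t.
Proof.
case/card_gt0P => t0 _ hadj.
have /trajectP[i lt_i fix_t0] := looping_order h t0.
pose t := iter i h t0; exists t.
have /(orbitPcycle 3 0) cyc : exists k, iter k.+1 h t = t.
  exists (fingraph.order h t0 - i).-1.
  by rewrite prednK ?subn_gt0 // /t -iterD subnK ?fix_t0 // ltnW.
have oadj : cycle (@adj T) (fingraph.orbit h t).
  by apply: sub_cycle cyc => x _ /eqP <-.
have : size (fingraph.orbit h t) <= 2.
  by apply: acT; rewrite /ucycle oadj orbit_uniq.
move: cyc => /(orbitPcycle 0 4) /=; rewrite size_orbit.
case: (fingraph.order h t) (order_gt0 h t) => [|[|[|]]] //= _ e _.
by have := hadj t; rewrite e adj_irr.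
Qed.

Hypothesis conT : connected T.

Section Subtree.
Variables (G : sgraph) (B : T -> {set G}).
Hypothesis conB : forall v, connected (induced [set t : T | v \in B t]).

Lemma connect_bags v t s s' : v \in B s -> v \in B s' -> v \notin B t ->
  connect (avoid t) s s'.
Proof.
move=> vs vs' vt.
pose S := [set t : T | v \in B t].
have connS (x y : {t | t \in S}) : connect (avoid t) (val x) (val y).
  have /connectP[p pP ->] := conB x y.
  apply/connectP; exists (map val p); last by rewrite last_map.
  apply: homo_path pP => a b ab; apply/and3P; split=> //.
    by apply: contraNneq vt => <-; have := valP a; rewrite inE.
  by apply: contraNneq vt => <-; have := valP b; rewrite inE.
have [Ss Ss'] : s \in S /\ s' \in S by rewrite !inE.
exact: (connS (Sub s Ss) (Sub s' Ss')).
Qed.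

(* The vertices outside [B t] whose subtree lies in the branch of [T] at [t]
   starting with the neighbour [t']. *)
Definition branch (t t' : T) : {set G} :=
  [set v | [&& v \notin B t, adj t t' &
            [exists s, (v \in B s) && connect (avoid t) t' s]]].

Lemma branchP t t' s v : v \notin B t -> adj t t' -> v \in B s ->
  reflect (connect (avoid t) t' s) (v \in branch t t').
Proof.
move=> vt tt' vs; rewrite inE vt tt'; apply: (iffP existsP) => [[r]|ts].
  by case/andP=> vr /connect_trans; apply; apply: connect_bags vt.
by exists s; rewrite vs.
Qed.

Lemma branch_adj t t' v : v \in branch t t' -> adj t t'.
Proof. by rewrite inE => /and3P[]. Qed.

Lemma branch_bag t t' v : v \in branch t t' -> v \notin B t.
Proof. by rewrite inE => /and3P[]. Qed.

Lemma branch_exists t s v : v \in B s -> v \notin B t ->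
  exists t', v \in branch t t'.
Proof.
move=> vs vt; have /connectP[p0 /shortenP[p pP up _] es] := conT t s.
case: p pP up es => [|a p] /=; first by move=> _ _ es; rewrite -es vs in vt.
case/andP=> ta pP /andP[]; rewrite inE negb_or => /andP[ta' tp] _ es.
exists a; apply/(branchP vt ta vs); apply/connectP; exists p => //.
by rewrite avoid_path 1?eq_sym // pP tp.
Qed.

(** Off [t], the node [s] is connected to both [a] and [b]. As adjacent vertices share a bag, this
    keeps them in one branch. *)
Lemma branch_share t a b s u v : u \in B s -> v \in B s ->
  u \in branch t a -> v \in branch t b -> a = b.
Proof.
move=> us vs ua vb; have [ta tb] := (branch_adj ua, branch_adj vb).
apply: (branch_unique ta tb); apply: connect_trans (_ : connect _ s b).
  exact/(branchP (branch_bag ua) ta us).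
rewrite avoid_sym; exact/(branchP (branch_bag vb) tb vs).
Qed.

(** Off [t], the node [s] is connected to [t'] and also to the second node [a] of a path from [t] to
    [s] that avoids [t']. This forces [a = t'], a contradiction. *)
Lemma branch_opposite t t' s u v : u \in B s -> v \in B s ->
  u \in branch t t' -> v \in branch t' t -> False.
Proof.
move=> us vs ut' vt; have [tt' t't] := (branch_adj ut', branch_adj vt).
have /(branchP (branch_bag ut') tt' us) t's := ut'.
have /(branchP (branch_bag vt) t't vs)/connectP[p0 /shortenP[p pP up _] es] :=
  vt.
have nst : s != t by apply: connect_avoid_neq t's; rewrite eq_sym adj_neq.
move: pP; rewrite avoid_path ?adj_neq // => /andP[pP t'p].
case: p pP up es t'p => [|a p]; first by move=> _ _ e; rewrite e eqxx in nst.
move=> /= /andP[ta pP] /andP[+ _] es; rewrite !inE !negb_or.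
move=> /andP[ta' tp] /andP[/eqP t'a _]; case: t'a.
apply: branch_unique tt' ta _; apply: connect_trans t's _.
rewrite avoid_sym; apply/connectP; exists p => //.
by rewrite avoid_path 1?eq_sym // pP tp.
Qed.

(** The path from [t] through [a] to [s] avoids [t'], since otherwise [a] and [t'] would start the
    same branch. *)
Lemma branch_other t t' a s v : v \in B s -> adj t t' ->
  v \in branch t a -> a != t' -> v \in branch t' t.
Proof.
move=> vs tt' va at'; have ta := branch_adj va; have vt := branch_bag va.
have vt' : v \notin B t'.
  apply: contraNN at' => vt'; apply/eqP; apply: branch_share va _; eauto.
  by apply/(branchP vt tt' vt'); apply: connect0.
apply/(branchP vt' _ vs); first by rewrite adj_sym.
apply: (@connect_trans _ _ a).
  by apply: connect1; rewrite /avoid /= ta at' adj_neq.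
have /(branchP vt ta vs)/connectP[p pP es] := va.
apply/connectP; exists p => //; move: (pP).
rewrite !avoid_path // 1?eq_sym ?adj_neq // => /andP[-> _] /=.
apply: contraNN at' => t'p; apply/eqP.
apply: branch_unique ta tt' _; have/path_connect := pP; apply.
by rewrite inE t'p orbT.
Qed.

End Subtree.
End Tree.

(** * Chains mod 2 and Stokes' formula *)

Section Chains.
Variable V : finType.
Local Open Scope ring_scope.
Implicit Types (K : V -> V -> V -> V -> bool) (C : V -> V -> V -> bool).

(** Coefficients lie in [bool] as the field with two elements: addition is exclusive or,
    multiplication is conjunction. *)
Definition sum3 C : bool := \sum_u \sum_v \sum_w C u v w.

Definition bd3 K u v w : bool :=
  \sum_t (K t u v w + K u t v w + K u v t w + K u v w t).

Definition bd2 C u v : bool := \sum_t (C t u v + C u t v + C u v t).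

Lemma eq_sum3 C C' : (forall u v w, C u v w = C' u v w) -> sum3 C = sum3 C'.
Proof. by move=> e; do 3!apply: eq_bigr => ? _. Qed.

Lemma sum3_0 C : (forall u v w, C u v w = 0) -> sum3 C = 0.
Proof. by move=> e; do 3!apply: big1 => ? _. Qed.

Lemma sum3D C C' : sum3 (fun u v w => C u v w + C' u v w) = sum3 C + sum3 C'.
Proof.
rewrite /sum3 -big_split; apply: eq_bigr => u _.
by rewrite -big_split; apply: eq_bigr => v _; rewrite -big_split.
Qed.

Lemma sum3_sum (I : finType) (C : I -> V -> V -> V -> bool) :
  sum3 (fun u v w => \sum_i C i u v w) = \sum_i sum3 (C i).
Proof.
rewrite /sum3 [RHS]exchange_big; apply: eq_bigr => u _.
rewrite [RHS]exchange_big; apply: eq_bigr => v _; exact: exchange_big.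
Qed.

(** Inserting [t] and [s] into [u v] gives twelve terms, which the exchange of [t] and [s] pairs
    off. *)
Lemma bd2_bd3 K u v : bd2 (bd3 K) u v = 0.
Proof.
pose F t s :=
  K s t u v + K t u s v + K t u v s + K u s t v + K u t v s + K u v s t.
transitivity (\sum_t \sum_s (F t s + F s t)).
  apply: eq_bigr => t _; rewrite -!big_split; apply: eq_bigr => s _ /=.
  rewrite /F; ring.
under eq_bigr do rewrite big_split.
by rewrite big_split /= exchange_big; apply: addbb.
Qed.

(** Reordering the sums moves the boundary from the chain [K] to the cochain [f]; the bracket is the
    coboundary of [f], without signs mod 2. *)
Lemma stokes3 K (f : V -> V -> V -> bool) :
  sum3 (fun u v w => bd3 K u v w * f u v w) =
  \sum_a sum3 (fun b c d =>
    K a b c d * (f b c d + f a c d + f a b d + f a b c)).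
Proof.
transitivity (\sum_t sum3 (fun u v w => K t u v w * f u v w)
  + \sum_u sum3 (fun t v w => K u t v w * f u v w)
  + \sum_u sum3 (fun v t w => K u v t w * f u v w)
  + \sum_u sum3 (fun v w t => K u v w t * f u v w)).
  rewrite -sum3_sum -!big_split; apply: eq_bigr => u _.
  rewrite /sum3 /= [X in _ + X + _ + _]exchange_big -!big_split;
    apply: eq_bigr => v _ /=.
  rewrite [X in _ + X + _ + _]exchange_big [X in _ + _ + X + _]exchange_big.
  rewrite -!big_split; apply: eq_bigr => w _.
  by rewrite /= -!big_split big_distrl; apply: eq_bigr => t _ /=;
    rewrite !mulrDl.
rewrite -!big_split; apply: eq_bigr => a _; rewrite /= -!sum3D.
by apply: eq_sum3 => b c d; rewrite !mulrDr.
Qed.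

Lemma stokes2 C (f : V -> V -> bool) :
  sum3 (fun u v w => C u v w * (f v w + f u w + f u v)) =
  \sum_u \sum_v bd2 C u v * f u v.
Proof.
transitivity (sum3 (fun t u v => C t u v * f u v)
  + sum3 (fun u t v => C u t v * f u v) + sum3 (fun u v t => C u v t * f u v)).
  by rewrite -!sum3D; apply: eq_sum3 => u v w; rewrite !mulrDr.
rewrite [X in X + _ + _]/sum3 exchange_big -!big_split;
  apply: eq_bigr => u _ /=.
rewrite [X in X + _ + _]exchange_big [X in _ + X + _]exchange_big -!big_split.
apply: eq_bigr => v _; rewrite /= -!big_split big_distrl;
  apply: eq_bigr => t _ /=.
by rewrite !mulrDl.
Qed.

End Chains.

(** * Incidences in the Kuhn triangulation, one coordinate at a time *)

Lemma sum_interval n p q :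
  (\sum_(t < n) (p <= t < q)%N)%R = odd (minn q n - p) :> bool.
Proof.
elim: n => [|n IHn]; first by rewrite big_ord0 minn0.
rewrite big_ord_recr /= {}IHn.
change (odd (minn q n - p) (+) (p <= n < q) = odd (minn q n.+1 - p)).
lia.
Qed.

Section CubeChains.
Variable n : nat.
Local Notation V := (cube_vertex n).
Implicit Types u v w a b c d : V.

Definition px u : nat := u.1.1.
Definition py u : nat := u.1.2.
Definition pz u : nat := u.2.

(* Simplices are weakly increasing, hence possibly degenerate: the conditions
   then split into one condition per coordinate. *)
Definition near (i j : nat) := i <= j <= i.+1.
Definition near3 i j k := [&& near i j, near i k & near j k].
Definition near4 i j k l := [&& near3 i j k, near i l, near j l & near k l].

Lemma cube_stepE u v : cube_step u v =
  [&& near (px u) (px v), near (py u) (py v) & near (pz u) (pz v)].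
Proof. by case: u v => [[? ?] ?] [[? ?] ?]. Qed.

Definition tri u v w :=
  [&& near3 (px u) (px v) (px w), near3 (py u) (py v) (py w)
    & near3 (pz u) (pz v) (pz w)].

Definition tet a b c d :=
  [&& near4 (px a) (px b) (px c) (px d), near4 (py a) (py b) (py c) (py d)
    & near4 (pz a) (pz b) (pz c) (pz d)].

Lemma vertex_eq u v : (u == v) = [&& px u == px v, py u == py v & pz u == pz v].
Proof.
by case: u v => [[? ?] ?] [[? ?] ?]; rewrite /eq_op /= /eq_op /= andbA.
Qed.

Local Open Scope ring_scope.

Lemma sum_box (f g h : nat -> bool) :
  \sum_(t : V) [&& f (px t), g (py t) & h (pz t)] =
  [&& \sum_(i < n) f i, \sum_(i < n) g i & \sum_(i < n) h i] :> bool.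
Proof.
transitivity ((\sum_(i < n) f i) * (\sum_(i < n) g i) * (\sum_(i < n) h i));
  last first.
  by rewrite -mulrA.
rewrite big_distrlr pair_big big_distrlr pair_big;
  apply: eq_bigr => -[[x y] z] _.
by rewrite andbA.
Qed.

(** The admissible [t] form an interval, and the parity of its length is needed. In the last two
    cases with [i = k] its length is 2, unless it is clipped at 0 or at [n.-1]. *)
Lemma sum_near4 i j k : near3 i j k -> (k < n)%N ->
  [/\ \sum_(t < n) near4 i t j k = (i == j) :> bool,
      \sum_(t < n) near4 i j t k = (j == k) :> bool,
      \sum_(t < n) near4 t i j k = (i != k) || (i == 0%N) :> bool
    & \sum_(t < n) near4 i j k t = (i != k) || (i == n.-1) :> bool].
Proof.
rewrite /near3 /near => ijk kn.
have E f p q : (forall t, (t < n)%N -> f t = (p <= t < q)%N) ->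
    \sum_(t < n) f t = odd (minn q n - p) :> bool.
  by move=> e; rewrite -sum_interval; apply: eq_bigr => t _; rewrite e.
split.
- rewrite (E (fun t => near4 i t j k) i j.+1) /near4 /near3 /near; lia.
- rewrite (E (fun t => near4 i j t k) j k.+1) /near4 /near3 /near; lia.
- rewrite (E (fun t => near4 t i j k) k.-1 i.+1) /near4 /near3 /near; lia.
- rewrite (E (fun t => near4 i j k t) k i.+2) /near4 /near3 /near; lia.
Qed.

(** Each insertion position contributes a product over the coordinates. The outer terms differ only
    if the triangle lies in a side of the cube; the middle ones concern degenerate triangles. *)
Lemma bd3_tet u v w : tri u v w ->
  bd3 tet u v w =
    [&& (px u != px w) || (px u == 0%N), (py u != py w) || (py u == 0%N)
      & (pz u != pz w) || (pz u == 0%N)] +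
    (u == v) + (v == w) +
    [&& (px u != px w) || (px u == n.-1), (py u != py w) || (py u == n.-1)
      & (pz u != pz w) || (pz u == n.-1)].
Proof.
case/and3P=> /sum_near4/(_ (ltn_ord _))[x1 x2 x0 x3].
move=> /sum_near4/(_ (ltn_ord _))[y1 y2 y0 y3].
move=> /sum_near4/(_ (ltn_ord _))[z1 z2 z0 z3].
rewrite /bd3 !big_split /tet /=.
rewrite (sum_box (fun t => near4 t _ _ _) (fun t => near4 t _ _ _)
  (fun t => near4 t _ _ _)) x0 y0 z0.
rewrite (sum_box (fun t => near4 _ t _ _) (fun t => near4 _ t _ _)
  (fun t => near4 _ t _ _)) x1 y1 z1.
rewrite (sum_box (fun t => near4 _ _ t _) (fun t => near4 _ _ t _)
  (fun t => near4 _ _ t _)) x2 y2 z2.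
rewrite (sum_box (near4 _ _ _) (near4 _ _ _) (near4 _ _ _)) x3 y3 z3.
by rewrite !vertex_eq.
Qed.


(** * The separating surface and its degree *)

Section Surface.
Variables L X : {set V}.
Hypothesis n_gt1 : (1 < n)%N.
Hypothesis LX : forall v, v \in L -> v \notin X.
Hypothesis L_step : forall v w, v \in L -> w \notin X ->
  cube_step v w || cube_step w v -> w \in L.
Hypothesis left_L : forall v, px v = 0%N -> v \in L.
Hypothesis right_LX : forall v, px v = n.-1 -> (v \notin L) && (v \notin X).

Definition filled a b c d :=
  tet a b c d && [|| a \in L, b \in L, c \in L | d \in L].

Definition surface u v w :=
  bd3 filled u v w && [&& u \in X, v \in X & w \in X].

(** Vertices of a tetrahedron are pairwise equal or adjacent, so [L_step] applies from its vertex in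
    [L]. *)
Lemma filled_LX a b c d : filled a b c d ->
  {in [:: a; b; c; d], forall v, v \notin X -> v \in L}.
Proof.
case/andP=> /and3P[xs ys zs] inL v vs vX.
have step : {in [:: a; b; c; d] &, forall p q, cube_step p q || cube_step q p}.
  have near_refl i : near i i by rewrite /near leqnn leqnSn.
  move: xs ys zs.
  move=> /and4P[/and3P[x1 x2 x3] x4 x5 x6] /and4P[/and3P[y1 y2 y3] y4 y5 y6].
  move=> /and4P[/and3P[z1 z2 z3] z4 z5 z6] p q; rewrite !inE.
  by move=> /or4P[]/eqP-> /or4P[]/eqP->; rewrite !cube_stepE ?near_refl //;
    apply/orP; (left; apply/and3P; split; assumption) || (right; apply/and3P;
      split; assumption).
have [p ps pL] : exists2 p, p \in [:: a; b; c; d] & p \in L.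
  by case/or4P: inL => ?; [exists a|exists b|exists c|exists d];
    rewrite ?inE ?eqxx ?orbT.
exact: L_step pL vX (step _ _ ps vs).
Qed.

Lemma bd3_neq0 (K : V -> V -> V -> V -> bool) u v w : bd3 K u v w ->
  exists t, [\/ K t u v w, K u t v w, K u v t w | K u v w t].
Proof.
move=> nz; apply: contrapT => none; move: nz; rewrite /bd3 big1 // => t _.
have : ~ [\/ K t u v w, K u t v w, K u v t w | K u v w t].
  by move=> ?; apply: none; exists t.
by case: (K t u v w); case: (K u t v w); case: (K u v t w);
  case: (K u v w t) => // -[];
  do ?[by constructor].
Qed.

Lemma bd3_filled_tri u v w : bd3 filled u v w -> tri u v w.
Proof.
case/bd3_neq0=> t [] /andP[/and3P[]]; rewrite /tri /near4 /near3 /near; lia.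
Qed.

Lemma bd3_filled_LX u v w : bd3 filled u v w ->
  {in [:: u; v; w], forall p, p \notin X -> p \in L}.
Proof.
case/bd3_neq0=> t [] /filled_LX h p; rewrite !inE => pp; apply: h; move: pp;
rewrite !inE; case/or3P=> ->; rewrite ?orbT //.
Qed.

Lemma bd3_filled_L u v w : [|| u \in L, v \in L | w \in L] ->
  bd3 filled u v w = bd3 tet u v w.
Proof.
move=> inL; apply: eq_bigr => t _; rewrite /filled.
by case/or3P: inL => ->; rewrite ?orbT /= !andbT.
Qed.

(* For the first and last vertex of a triangle: the triangle is not contained in
   a side of the cube orthogonal to this coordinate. *)
Definition inner i k := (i == k) ==> (0 < i < n.-1)%N.

(** If the coefficient were nonzero, a vertex outside [X] would be in [L]. All tetrahedra at the
    triangle would then belong to [filled], and off the sides of the cube they cancel. *)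
Lemma bd3_filled_inner u v w : u != v -> v != w ->
  inner (px u) (px w) -> inner (py u) (py w) -> inner (pz u) (pz w) ->
  ~~ [&& u \in X, v \in X & w \in X] -> bd3 filled u v w = false.
Proof.
move=> uv vw ix iy iz nX; apply/negP => nz.
have uvw := bd3_filled_tri nz.
move: (nz); rewrite bd3_filled_L; last first.
  have h := bd3_filled_LX nz.
  move: nX; rewrite !negb_and.
  by case/or3P=> /h->; rewrite ?inE ?eqxx ?orbT.
rewrite (bd3_tet uvw) (negPf uv) (negPf vw).
have E i k : inner i k -> ((i != k) || (i == 0%N) = (i != k))
  /\ ((i != k) || (i == n.-1) = (i != k)).
  rewrite /inner; case: eqVneq => //= _ /andP[i_gt0 i_lt].
  by rewrite gtn_eqF // ltn_eqF.
have [-> ->] := E _ _ ix; have [-> ->] := E _ _ iy; have [-> ->] := E _ _ iz.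
by case: [&& _, _ & _].
Qed.

(* Over pairs of vertices of a simplex, [cut] is the coboundary of the
   indicator of [i < f]; [deg i j] evaluates the cup product of the
   coboundaries for [y] and [z], which only sees the triangles over
   (i, j), (i+1, j), (i+1, j+1). *)
Definition cut (f : V -> nat) i u v := (i < f u)%N (+) (i < f v)%N.

Definition deg i j (C : V -> V -> V -> bool) : bool :=
  sum3 (fun u v w => C u v w * (cut py i u v * cut pz j v w)).

Lemma cut_near (f : V -> nat) i u v : near (f u) (f v) ->
  cut f i u v = (f u == i) && (f v == i.+1).
Proof. rewrite /cut /near; lia. Qed.

(** A cup product of two coboundaries is a cocycle, so it vanishes on boundaries. *)
Lemma deg_bd3 i j K : deg i j (bd3 K) = 0.
Proof.
rewrite /deg stokes3; apply: big1 => a _; apply: sum3_0 => b c d.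
rewrite /cut; move: (K a b c d) => k.
case: k; last by rewrite mul0r.
by do 4!case: (i < _)%N; do 4!case: (j < _)%N.
Qed.

(** The whole boundary of [filled] has degree 0. Among the triangles seen by [deg i j], it differs
    from [surface] in exactly one, [u0 v0 w0] in the side [x = 0]. *)
Lemma deg_surface i j : (i.+1 < n)%N -> (j.+1 < n)%N -> deg i j surface = 1.
Proof.
move=> ni nj.
pose o := Ordinal (ltnW n_gt1).
pose u0 : V := (o, Ordinal (ltnW ni), Ordinal (ltnW nj)).
pose v0 : V := (o, Ordinal ni, Ordinal (ltnW nj)).
pose w0 : V := (o, Ordinal ni, Ordinal nj).
have single : sum3 (fun u v w => [&& u == u0, v == v0 & w == w0]) = 1.
  rewrite /sum3 (bigD1 u0) //= [X in _ + X]big1 => [|u /negPf u0u]; last first.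
    by apply: big1 => v _; apply: big1 => w _; rewrite u0u.
  rewrite (bigD1 v0) //= [X in _ + X + _]big1 => [|v /negPf v0v]; last first.
    by apply: big1 => w _; rewrite v0v andbF.
  rewrite (bigD1 w0) //= big1 => [|w /negPf w0w]; last by rewrite w0w !andbF.
  by rewrite !eqxx.
rewrite -single -[RHS]add0r -(deg_bd3 i j filled) /deg -sum3D.
apply: eq_sum3 => u v w; rewrite /surface.
have [/and3P[/eqP-> /eqP-> /eqP->]|not0] :=
  boolP [&& u == u0, v == v0 & w == w0].
  have tri0 : tri u0 v0 w0 by rewrite /tri /near3 /near /px /py /pz /=; lia.
  have u0L : u0 \in L by apply: left_L.
  rewrite (negPf (LX u0L)) /= andbF bd3_filled_L ?u0L // (bd3_tet tri0).
  rewrite !vertex_eq /cut /px /py /pz /=.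
  rewrite (ltn_eqF (ltnSn i)) (ltn_eqF (ltnSn j)) !ltnn !ltnSn.
  have n1_gt0 : (0 < n.-1)%N by rewrite -subn1 subn_gt0.
  by rewrite (ltn_eqF n1_gt0) !andbF.
rewrite addr0; have [nz|//] := boolP (bd3 filled u v w).
have [//|nX] := boolP [&& u \in X, v \in X & w \in X].
have uvw := bd3_filled_tri nz.
have /and3P[/and3P[xuv xuw xvw] /and3P[yuv yuw yvw] /and3P[zuv zuw zvw]] := uvw.
rewrite (cut_near _ yuv) (cut_near _ zvw).
set phi := (X in _ * X = _); have [|nphi] := boolP phi;
  last by rewrite -[RHS]/(true && phi) (negPf nphi).
case/andP=> /andP[/eqP yu /eqP yv] /andP[/eqP zv /eqP zw].
have yw : py w = i.+1 by move: yuw yvw; clear -yu yv; rewrite /near; lia.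
have zu : pz u = j by move: zuv zuw; clear -zv zw; rewrite /near; lia.
have u_v : u != v by rewrite vertex_eq yu yv (ltn_eqF (ltnSn i)) andbF.
have v_w : v != w by rewrite vertex_eq zv zw (ltn_eqF (ltnSn j)) !andbF.
have iy : inner (py u) (py w) by rewrite /inner yu yw (ltn_eqF (ltnSn i)).
have iz : inner (pz u) (pz w) by rewrite /inner zu zw (ltn_eqF (ltnSn j)).
have [ix|nix] := boolP (inner (px u) (px w)).
  by rewrite (bd3_filled_inner u_v v_w ix iy iz nX) in nz.
have [xv xw] : px v = px u /\ px w = px u.
  by move: nix xuv xvw; clear; rewrite /inner /near; lia.
(* Some vertex of the triangle is outside [X], hence in [L], and [L] misses the right side. *)
have p0 : px u != n.-1.
  apply/eqP => xu; have h := bd3_filled_LX nz.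
  move: nX; rewrite !negb_and => /or3P[] pX.
  - by have := right_LX xu; rewrite h ?inE ?eqxx.
  - by have := right_LX (etrans xv xu); rewrite h ?inE ?eqxx ?orbT.
  - by have := right_LX (etrans xw xu); rewrite h ?inE ?eqxx ?orbT.
have xu : px u = 0%N.
  have un : (px u < n)%N := ltn_ord _.
  by move: nix p0 un; rewrite xw /inner; clear; lia.
case/negP: not0; rewrite !vertex_eq xv xw xu yu yv yw zu zv zw.
by rewrite /px /py /pz /= !eqxx.
Qed.

Lemma near3_inner i j k : near3 i j k -> inner i j || inner j k -> inner i k.
Proof. by clear; rewrite /near3 /near /inner; lia. Qed.

Lemma X_inner u v : (u \in X) || (v \in X) -> inner (px u) (px v).
Proof.
move=> uvX; apply/implyP => /eqP uv.
have [w wX ->] : exists2 w, w \in X & px u = px w.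
  by case/orP: uvX; [exists u|exists v].
rewrite lt0n; apply/andP; split.
  by apply: contraTneq wX => /left_L; apply: LX.
have : px w != n.-1 by apply: contraTneq wX => /right_LX /andP[].
have : (px w < n)%N := ltn_ord _.
by clear; lia.
Qed.

Definition part (D : {set V}) u v w :=
  surface u v w && [|| u \in D, v \in D | w \in D].

Lemma part_tri D u v w : part D u v w -> tri u v w.
Proof. by case/andP=> /andP[/bd3_filled_tri]. Qed.

Lemma bd2_part_near D u v : bd2 (part D) u v ->
  [/\ near (px u) (px v), near (py u) (py v) & near (pz u) (pz v)].
Proof.
move=> nz; have [t] : exists t, [\/ tri t u v, tri u t v | tri u v t].
  apply: contrapT => none; move: nz; rewrite /bd2 big1 // => t _.
  have : ~ [\/ tri t u v, tri u t v | tri u v t].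
    by move=> ?; apply: none; exists t.
  case E1: (part D t u v); first by case; constructor; apply: part_tri E1.
  case E2: (part D u t v); first by case; constructor; apply: part_tri E2.
  by case E3: (part D u v t) => // -[]; constructor; apply: part_tri E3.
by case=> /and3P[/and3P[? ? ?] /and3P[? ? ?] /and3P[? ? ?]].
Qed.

Lemma tri_step u v w : tri u v w ->
  {in [:: u; v; w] &, forall p q, cube_step p q || cube_step q p}.
Proof.
have near_refl i : near i i by rewrite /near leqnn leqnSn.
move=> /and3P[/and3P[x1 x2 x3] /and3P[y1 y2 y3] /and3P[z1 z2 z3]] p q;
  rewrite !inE.
by move=> /or3P[]/eqP-> /or3P[]/eqP->; rewrite !cube_stepE ?near_refl //;
  apply/orP; (left; apply/and3P; split; assumption) || (right; apply/and3P;
    split; assumption).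
Qed.

(** * Degrees of the pieces into which a bag cuts the surface *)

Section Part.
Variables B D : {set V}.
Hypothesis D_closed : forall u v, u \in X -> u \notin B -> v \in D ->
  cube_step u v || cube_step v u -> u \in D.

(** Off the four sides [surface] has no boundary, and by [D_closed] its triangles at [u] belong to
    [part D] either all or not at all. *)
Lemma bd2_part u v : u != v -> u \notin B ->
  inner (py u) (py v) -> inner (pz u) (pz v) -> bd2 (part D) u v = false.
Proof.
move=> uv uB iy iz.
have [/andP[uX vX]|nX] := boolP ((u \in X) && (v \in X)); last first.
  rewrite /bd2 big1 // => t _; rewrite /part /surface.
  by move: nX; case: (u \in X); case: (v \in X); rewrite ?andbF.
have surfE : bd2 surface u v = 0.
  rewrite -[RHS](bd2_bd3 filled u v); apply: eq_bigr => t _.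
  rewrite /surface uX vX /= !andbT.
  have [tX|tX] := boolP (t \in X); first by rewrite !andbT.
  have tu : t != u by apply: contraNneq tX => ->.
  have [ut tv] : u != t /\ t != v by rewrite eq_sym tu; split=> //;
    apply: contraNneq tX => ->.
  have vt : v != t by rewrite eq_sym.
  (* Triangles on the edge whose third vertex [t] is outside [X] have coefficient 0, so restricting
     to [X] loses nothing. *)
  have off a b c : a != b -> b != c -> ~~ [&& a \in X, b \in X & c \in X] ->
      inner (px a) (px c) ->
      (tri a b c -> inner (py a) (py c) /\ inner (pz a) (pz c)) ->
      bd3 filled a b c = false.
    move=> ab bc nX ix iyz; apply/negP => nz.
    have [iy' iz'] := iyz (bd3_filled_tri nz).
    by rewrite (bd3_filled_inner ab bc ix iy' iz' nX) in nz.
  rewrite (off t u v) ?(off u t v) ?(off u v t) ?uX ?vX ?(negPf tX) ?X_inner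
    ?uX ?vX ?orbT // => /and3P[_ yt zt].
    by split; [apply: near3_inner yt _|apply: near3_inner zt _];
      rewrite ?iy ?iz.
  by split; [apply: near3_inner yt _|apply: near3_inner zt _];
    rewrite ?iy ?iz ?orbT.
transitivity (bd2 surface u v * (u \in D)); last by rewrite surfE mul0r.
rewrite /bd2 big_distrl; apply: eq_bigr => t _ /=; rewrite !mulrDl /part.
have partE a b c : u \in [:: a; b; c] ->
    surface a b c && [|| a \in D, b \in D |
      c \in D] = surface a b c * (u \in D).
  move=> uabc; have [sf|//] := boolP (surface a b c).
  have step := tri_step (bd3_filled_tri (proj1 (andP sf))).
  have closed v' : v' \in [:: a; b; c] -> v' \in D -> u \in D.
    by move=> v'abc v'D; apply: D_closed uX uB v'D (step _ _ uabc v'abc).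
  rewrite -[RHS]/(u \in D) /=; apply/idP/idP => [|uD].
    by case/or3P; apply: closed; rewrite !inE eqxx ?orbT.
  by move: uabc; rewrite !inE => /or3P[]/eqP<-; rewrite uD ?orbT.
by rewrite !partE // !inE eqxx ?orbT.
Qed.

(** Only the value [i] is forbidden: an edge [u v] of a simplex with nonzero [cut f i] has
    [f u = i], which puts [u] outside [B]. *)
Definition unhit (f : V -> nat) i := forall v, v \in B -> f v != i.

Lemma deg_part_col i j j' : unhit py i -> (j.+1 < n)%N -> (j'.+1 < n)%N ->
  deg i j (part D) = deg i j' (part D).
Proof.
move=> iB jn jn'.
suff : deg i j (part D) + deg i j' (part D) = 0 by do 2!case: (deg _ _ _).
(* The coboundary of [f] is the sum of the two cup products that define the degrees. *)
pose f u v := cut py i u v * ((j < pz v)%N + (j' < pz v)%N).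
transitivity (sum3 (fun u v w => part D u v w * (f v w + f u w + f u v))).
  rewrite /deg -sum3D; apply: eq_sum3 => u v w; rewrite /f /cut.
  case: (part D u v w); last by rewrite !mul0r.
  by do 3!case: (i < _)%N; do 2!case: (j < _)%N; do 2!case: (j' < _)%N.
rewrite stokes2; apply: big1 => u _; apply: big1 => v _.
apply: negbTE; apply/negP => /andP[nz /andP[cuv gv]]; have [_ yuv zuv] :=
  bd2_part_near nz.
move: cuv; rewrite (cut_near _ yuv) => /andP[/eqP yu /eqP yv].
have uB : u \notin B by apply: contraPN yu => /iB/eqP.
have uv : u != v by rewrite vertex_eq yu yv (ltn_eqF (ltnSn i)) andbF.
have iy : inner (py u) (py v) by rewrite /inner yu yv (ltn_eqF (ltnSn i)).
(* One of [j], [j'] is below [pz v] and the other is not, so [pz v] is strictly between 0 and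
   [n.-1]. *)
have iz : inner (pz u) (pz v).
  have : (j < pz v)%N (+) (j' < pz v)%N by [].
  by rewrite /inner; move: jn jn'; clear; lia.
by rewrite bd2_part in nz.
Qed.

Lemma deg_part_row i i' j : unhit pz j -> (i.+1 < n)%N -> (i'.+1 < n)%N ->
  deg i j (part D) = deg i' j (part D).
Proof.
move=> jB ni ni'.
suff : deg i j (part D) + deg i' j (part D) = 0 by do 2!case: (deg _ _ _).
(* Now the [y] factor, the first of the cup product, varies, so its indicator is read at the first
   vertex. *)
pose f u v := ((i < py u)%N + (i' < py u)%N) * cut pz j u v.
transitivity (sum3 (fun u v w => part D u v w * (f v w + f u w + f u v))).
  rewrite /deg -sum3D; apply: eq_sum3 => u v w; rewrite /f /cut.
  case: (part D u v w); last by rewrite !mul0r.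
  by do 2!case: (i < _)%N; do 2!case: (i' < _)%N; do 3!case: (j < _)%N.
rewrite stokes2; apply: big1 => u _; apply: big1 => v _.
apply: negbTE; apply/negP => /andP[nz /andP[gu cuv]]; have [_ yuv zuv] :=
  bd2_part_near nz.
move: cuv; rewrite (cut_near _ zuv) => /andP[/eqP zu /eqP zv].
have uB : u \notin B by apply: contraPN zu => /jB/eqP.
have uv : u != v by rewrite vertex_eq zu zv (ltn_eqF (ltnSn j)) !andbF.
have iz : inner (pz u) (pz v) by rewrite /inner zu zv (ltn_eqF (ltnSn j)).
have iy : inner (py u) (py v).
  have : (i < py u)%N (+) (i' < py u)%N by [].
  by rewrite /inner => h; apply/implyP => _; move: h ni ni'; clear; lia.
by rewrite bd2_part in nz.
Qed.

Lemma deg_part i i' j j' : unhit py i -> unhit pz j' ->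
  (i.+1 < n)%N -> (i'.+1 < n)%N -> (j.+1 < n)%N -> (j'.+1 < n)%N ->
  deg i j (part D) = deg i' j' (part D).
Proof.
by move=> iB jB *; rewrite (deg_part_col (j' := j')) // (deg_part_row (i' :=
  i')).
Qed.

End Part.

(** By pigeonhole: there are [n.-1] candidates for [i]. *)
Lemma exists_unhit (B : {set V}) (f : V -> nat) :
  (#|B| < n.-1)%N -> exists2 i, (i.+1 < n)%N & unhit B f i.
Proof.
move=> cardB; apply: contrapT => none.
suff : (n.-1 <= #|B|)%N by rewrite leqNgt cardB.
rewrite -(size_iota 0 n.-1) cardE -(size_map f).
apply: uniq_leq_size (iota_uniq _ _) _ => i; rewrite mem_iota /= => ilt.
apply: contrapT => /negP iB; apply: none; exists i.
  by move: ilt; clear; lia.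
move=> v vB; apply: contraNneq iB => <-.
by rewrite map_f // mem_enum.
Qed.

(** * Degrees of the branches of a tree decomposition *)

Section Decomposition.
Variables (T : sgraph) (B : T -> {set V}) (D : T -> T -> {set V}) (k : nat).
Local Notation close u v := (cube_step u v || cube_step v u).
Hypothesis treeT : is_tree T.
Hypothesis cardB : forall t, (#|B t| <= k)%N.
Hypothesis D_exists : forall t v, v \in X -> v \notin B t ->
  exists t', v \in D t t'.
Hypothesis D_adj : forall t t' v, v \in D t t' -> adj t t'.
Hypothesis D_unique : forall t t1 t2 u v, u \in D t t1 -> v \in D t t2 ->
  close u v -> t1 = t2.
Hypothesis D_opposite : forall t t' u v, u \in D t t' -> v \in D t' t ->
  ~~ close u v.
Hypothesis D_other : forall t t' t1 v, adj t t' -> v \in D t t1 -> t1 != t' ->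
  v \in D t' t.

Lemma D_closed t t' u v : u \in X -> u \notin B t -> v \in D t t' ->
  close u v -> u \in D t t'.
Proof.
move=> uX uB vD uv; have [a uD] := D_exists uX uB.
by rewrite -(D_unique uD vD uv).
Qed.

Lemma partE t t' u v w : surface u v w -> u \in X -> u \notin B t ->
  part (D t t') u v w = (u \in D t t').
Proof.
move=> sf uX uB; rewrite /part sf /=; apply/idP/idP => [|->//].
have step := tri_step (bd3_filled_tri (proj1 (andP sf))).
by case/or3P=> [//|vD|wD];
  [apply: D_closed uX uB vD _|apply: D_closed uX uB wD _];
  apply: step; rewrite !inE eqxx ?orbT.
Qed.

Lemma surface_cut i u v w (S : {set V}) : unhit S py i ->
  surface u v w -> cut py i u v -> u \in X /\ u \notin S.
Proof.
move=> iS sf cuv; have /andP[/bd3_filled_tri/and3P[_ /and3P[yuv _ _] _]] := sf.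
case/and3P=> uX _ _; split=> //.
move: cuv; rewrite (cut_near _ yuv) => /andP[/eqP yu _].
by apply: contraPN yu => /iS/eqP.
Qed.

(** A triangle that counts has its first vertex in the row [y = i], hence outside [B t] and in
    exactly one branch, the only one that the triangle meets. *)
Lemma deg_branch_sum t i j : unhit (B t) py i -> (i.+1 < n)%N -> (j.+1 < n)%N ->
  \sum_t' deg i j (part (D t t')) = 1.
Proof.
move=> iB ni nj; rewrite -(deg_surface ni nj) -sum3_sum.
apply: eq_sum3 => u v w.
have [sf|nsf] := boolP (surface u v w); last first.
  by apply: big1 => t' _; rewrite /part (negPf nsf) /= mul0r.
have [cuv|] := boolP (cut py i u v); last first.
  by rewrite mul0r mulr0 => _; apply: big1 => t' _; rewrite mulr0.
have [uX uB] := surface_cut iB sf cuv; have [a uD] := D_exists uX uB.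
rewrite (bigD1 a) //= big1 ?addr0 ?partE ?uD // => b ba.
rewrite partE // [_ \in _](_ : _ = false) ?mul0r //.
apply: contraNF ba => uDb; apply/eqP; apply: D_unique uDb uD _.
by rewrite cube_stepE /near !leqnn !leqnSn.
Qed.

(** The first vertex of a triangle that counts lies in some branch at [t]: either that of [t'], or
    another one, which is contained in the branch of [t] at [t']. [D_opposite] excludes both at
    once. *)
Lemma deg_branch_opposite t t' i j :
  adj t t' -> unhit (B t) py i -> (i.+1 < n)%N -> (j.+1 < n)%N ->
  deg i j (part (D t t')) + deg i j (part (D t' t)) = 1.
Proof.
move=> tt' iB ni nj; rewrite -(deg_surface ni nj) -sum3D.
apply: eq_sum3 => u v w.
have [sf|nsf] := boolP (surface u v w); last first.
  by rewrite /part (negPf nsf) /= !mul0r addr0.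
have [cuv|] := boolP (cut py i u v); last by rewrite !mul0r !mulr0 addr0.
have [uX uB] := surface_cut iB sf cuv; have [a uD] := D_exists uX uB.
rewrite -mulrDl partE //; congr (_ * _).
have step := tri_step (bd3_filled_tri (proj1 (andP sf))).
have [eq_a|neq_a] := eqVneq a t'.
  rewrite -eq_a uD eq_a /part sf /=;
    suff -> : [|| u \in D t' t, v \in D t' t | w \in D t' t] = false by [].
  rewrite eq_a in uD.
  apply/negP => /or3P[] /(D_opposite uD)/negP[]; apply: step;
  by rewrite !inE eqxx ?orbT.
rewrite /part sf (D_other tt' uD neq_a) /=.
suff -> : (u \in D t t') = false by [].
apply: contraNF neq_a => uD'; apply/eqP; apply: D_unique uD uD' _.
by rewrite cube_stepE /near !leqnn !leqnSn.
Qed.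

Lemma bag_bound : (n.-1 <= k.*2)%N.
Proof.
rewrite leqNgt; apply/negP => kn.
have [T_gt0 _ acT] := treeT.
have card2 t t' : (#|B t :|: B t'| < n.-1)%N.
  apply: leq_ltn_trans kn; rewrite -addnn (leq_trans (leq_card_setU _ _)) //.
  by rewrite leq_add.
have unhitU t t' f i : unhit (B t :|: B t') f i -> unhit (B t) f i
  /\ unhit (B t') f i.
  by move=> h; split=> v vB; apply: h; rewrite inE vB ?orbT.
have /choice[h hP] : forall t, exists t', adj t t' /\
    forall i j, unhit (B t) py i -> unhit (B t) pz j -> (i.+1 < n)%N ->
      (j.+1 < n)%N -> deg i j (part (D t t')).
  move=> t.
  have [i ni /unhitU[iB _]] := exists_unhit py (card2 t t).
  have [j nj /unhitU[jB _]] := exists_unhit pz (card2 t t).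
  have [t' degt'] : exists t', deg i j (part (D t t')).
    apply: contrapT => none; have := deg_branch_sum iB ni nj.
    by rewrite big1 // => t' _; apply: negbTE; apply/negP => degt';
      apply: none; exists t'.
  exists t'; split.
    (* For a non-neighbour [t'] the set [D t t'] is empty, so its degree is 0. *)
    apply: contraT => ntt'; move: degt'; rewrite /deg sum3_0 // => u v w.
    rewrite /part; suff -> : D t t' = set0 by rewrite !inE /= andbF mul0r.
    by apply/setP => v'; rewrite inE; apply: contraNF ntt'; apply: D_adj.
  move=> i' j' iB' jB' ni' nj'.
  by rewrite (deg_part (@D_closed t t') iB' jB ni' ni nj' nj).
have [t hht] := tree_fixed_edge acT T_gt0 (fun t => (hP t).1).
have [i ni /unhitU[iB iB']] := exists_unhit py (card2 t (h t)).
have [j nj /unhitU[jB jB']] := exists_unhit pz (card2 t (h t)).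
(* Both opposite branches have degree 1, yet their degrees sum to 1 mod 2. *)
have := deg_branch_opposite (hP t).1 iB ni nj.
rewrite (hP t).2 //; have := (hP (h t)).2 i j iB' jB' ni nj.
by rewrite hht => ->.
Qed.

End Decomposition.
End Surface.
End CubeChains.

(** * From separators of the cube to the tree-width bound *)

Lemma separator_bag_bound (n : nat) (X : {set Q n})
    (T : sgraph) (B : T -> {set induced X}) (k : nat) :
  1 < n -> X \subset ~: (left_side n :|: right_side n) ->
  meets_every_path (left_side n) (right_side n) X ->
  is_tree_decomposition B -> (forall t, #|B t| <= k) -> n.-1 <= k.*2.
Proof.
move=> n_gt1 hX hsep [treeT cover edges conB] cardB.
have [_ conT acT] := treeT.
have leftE (v : Q n) : (v \in left_side n) = (px v == 0).
  by rewrite inE; case: v => [[]].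
have rightE (v : Q n) : (v \in right_side n) = (px v == n.-1).
  by rewrite inE; case: v => [[]].
have X_out v : v \in X -> (px v != 0) && (px v != n.-1).
  by move=> /(subsetP hX); rewrite in_setC in_setU negb_or leftE rightE.
pose e : rel (Q n) := [rel u v | [&& adj u v, u \notin X & v \notin X]].
pose L := [set v | [exists u, (u \in left_side n) && connect e u v]].
have LX v : v \in L -> v \notin X.
  rewrite inE => /existsP[u /andP[uleft /connectP[p pP ->]]].
  elim/last_ind: p pP => [_|p w _] /=.
    by apply: contraTN uleft => /X_out; rewrite leftE => /andP[].
  by rewrite rcons_path last_rcons => /andP[_ /and3P[]].
have L_step v w : v \in L -> w \notin X -> cube_step v w || cube_step w v ->
  w \in L.
  move=> vL wX vw; have [<- //|neq_vw] := eqVneq v w.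
  move: (vL); rewrite !inE => /existsP[u /andP[uleft uv]].
  apply/existsP; exists u; rewrite uleft; apply: connect_trans uv (connect1 _).
  by rewrite /e /= (LX _ vL) wX /= andbT /cube_adj neq_vw.
have left_L v : px v = 0 -> v \in L.
  move=> v0; rewrite inE; apply/existsP; exists v.
  by rewrite leftE v0 eqxx connect0.
have right_LX v : px v = n.-1 -> (v \notin L) && (v \notin X).
  move=> vn; apply/andP; split; last first.
    by apply/negP => /X_out; rewrite vn eqxx andbF.
  apply/negP; rewrite inE => /existsP[u /andP[uleft uv]].
  have uL : u \in L by rewrite inE; apply/existsP; exists u;
    rewrite uleft connect0.
  (* A simple path from left to right must meet [X], but [u] is in [L] and every later vertex ends
     an edge of [e]. *)
  case/connectP: uv => p0 /shortenP[p pP up _] ev.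
  have uX := LX _ uL.
  have [w wp] : exists2 w, w \in u :: p & w \in X.
    apply: hsep; split=> //; last by rewrite -ev rightE vn.
    by apply: sub_path pP => x y /and3P[].
  apply/negP; move: wp; rewrite inE => /predU1P[-> //|wp].
  case/splitPr: wp pP => p1 p2; rewrite cat_path => /andP[_ /= /andP[/and3P[]]].
  by [].
pose toV (S : {set induced X}) : {set Q n} := val @: S.
(* Equal vertices share a bag by [cover], adjacent ones by [edges]. *)
have share (x y : induced X) :
    cube_step (val x) (val y) || cube_step (val y) (val x) ->
    exists s, (x \in B s) && (y \in B s).
  move=> xy; have [<-|neq_xy] := eqVneq x y.
    by have [s xs] := cover x; exists s; rewrite xs.
  by apply: edges;
    rewrite /adj /= /induced_adj /= /cube_adj (inj_eq val_inj) neq_xy.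
apply: (@bag_bound n L X n_gt1 LX L_step left_L right_LX T
  (fun t => toV (B t)) (fun t t' => toV (branch B t t')) k treeT).
- by move=> t; apply: leq_trans (leq_imset_card _ _) (cardB t).
- move=> t v vX; pose x : induced X := Sub v vX; rewrite -[v]/(val x) => vB.
  have {}vB : x \notin B t by apply: contraNN vB => xB; apply: imset_f.
  have [s xs] := cover x; have [t' xt'] := branch_exists conT conB xs vB.
  by exists t'; apply: imset_f.
- by move=> t t' _ /imsetP[v vt' _]; apply: branch_adj vt'.
- move=> t a b u' v' /imsetP[u ua eu] /imsetP[v vb ev];
  rewrite eu ev => /share[s /andP[us vs]].
  exact (branch_share acT conB us vs ua vb).
- move=> t t' _ _ /imsetP[u ua ->] /imsetP[v vb ->].
  apply/negP => /share[s /andP[us vs]].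
  exact (branch_opposite acT conB us vs ua vb).
- move=> t t' a _ tt' /imsetP[v va ->] at'.
  have [s vs] := cover v.
  apply: imset_f; exact (branch_other acT conB vs tt' va at').
Qed.

Theorem theorem3 (R : realType) (n : nat) (hn : 1 <= n) (X : {set Q n})
    (hX : X \subset ~: (left_side n :|: right_side n))
    (hsep : meets_every_path (left_side n) (right_side n) X) :
  (n%:R / Num.sqrt 18%:R - 1 <= (treewidth (induced X))%:~R :> R)%R.
Proof.
(* For [n = 1] the single vertex is a path from left to right, so [X] would meet the sides. *)
have n_gt1 : 1 < n.
  rewrite ltn_neqAle hn andbT; apply/eqP => n1; subst n.
  have [|w _ /(subsetP hX)] := hsep (ord0, ord0, ord0) [::].
    by split; rewrite ?inE.
  by case: w => [[x y] z]; rewrite !inE ord1.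
rewrite /treewidth; case: ex_minnP => k /asboolP[T [B [decB maxB]]] _.
have n_le : n.-1 <= k.*2.
  apply: separator_bag_bound n_gt1 hX hsep decB _ => t.
  by rewrite -maxB; apply: leq_bigmax.
(* Since [n] is at least 2, [k] is positive, so [n <= 2 * k + 1] suffices. The factor 4 is enough
   because 16 is at most 18. *)
have n_le4 : n <= 4 * k by lia.
rewrite rmorphB /= lerD2r ler_pdivrMr ?sqrtr_gt0 ?ltr0n //.
have sqrt_ge4 : (4%:R <= Num.sqrt 18%:R :> R)%R.
  rewrite -[leLHS]ger0_norm ?ler0n // -sqrtr_sqr ler_sqrt ?ler0n //.
  by rewrite -natrX ler_nat.
apply: (@le_trans _ _ (k%:R * 4%:R)%R); last by rewrite ler_wpM2l.
by rewrite -natrM ler_nat mulnC.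
Qed.
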